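(* Suppose that $f$ has the MLR property, i.e. $f(x_1-\eta_1)f(x_2-\eta_2)\ge f(x_1-\eta_2)f(x_2-\eta_1)$ whenever $x_1<x_2$ and $\eta_1<\eta_2$, and that $W$ satisfies (C1)--(C3) (listed in the context). For $u>0$ let $m(\boldsymbol0,u)$ be the median of the conditional distribution of $X_{(2)}-\theta_{(2)}$ given $U=u$ when $\boldsymbol\theta=\boldsymbol0=(0,0)$. Let $\delta_\phi(\mathbf X)=X_{(2)}-\phi(U)$ be an estimator of $\theta_{(2)}$ such that $P_{\boldsymbol\theta}(\phi(U)>m(\boldsymbol0,U))\ne0$ for some $\boldsymbol\theta\in\mathbb{R}^2$. Then the estimator $$\delta_{\phi_0}(\mathbf X)=X_{(2)}-\min\{\phi(U),m(\boldsymbol0,U)\}$$ improves over $\delta_\phi$ in terms of the generalized Pitman nearness criterion with loss $W(a-\theta_{(2)})$; that is, $GPN(\delta_{\phi_0},\delta_\phi;\boldsymbol\theta)\ge\frac12$ for all $\boldsymbol\theta\in\mathbb{R}^2$, with strict inequality for some $\boldsymbol\theta$.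
   Context: Setting: $f$ is a Lebesgue probability density on $\mathbb{R}$; $X_1,X_2$ are independent and $X_i$ has density $x\mapsto f(x-\theta_i)$, where $\boldsymbol\theta=(\theta_1,\theta_2)\in\mathbb{R}^2$ is unknown. Write $\theta_{(1)}=\min\{\theta_1,\theta_2\}$, $\theta_{(2)}=\max\{\theta_1,\theta_2\}$, $X_{(1)}=\min\{X_1,X_2\}$, $X_{(2)}=\max\{X_1,X_2\}$, $U=X_{(2)}-X_{(1)}$, $\mathbf X=(X_1,X_2)$, $\phi:[0,\infty)\to\mathbb{R}$. With $\theta=\theta_{(2)}-\theta_{(1)}\ge0$, the conditional distribution of $X_{(2)}-\theta_{(2)}$ given $U=u>0$ has density proportional to $z\mapsto f(z-u+\theta)f(z)+f(z-u)f(z+\theta)$; implicitly it is well defined and has a unique median. For $\boldsymbol\theta=\boldsymbol0$ the density is proportional to $f(z-u)f(z)$. Generalized Pitman nearness: for estimators $\delta_1,\delta_2$ of $\theta_{(2)}$ and loss $L(\boldsymbol\theta,a)=W(a-\theta_{(2)})$, $GPN(\delta_1,\delta_2;\boldsymbol\theta)=P_{\boldsymbol\theta}[L(\boldsymbol\theta,\delta_1)<L(\boldsymbol\theta,\delta_2)]+\frac12P_{\boldsymbol\theta}[L(\boldsymbol\theta,\delta_1)=L(\boldsymbol\theta,\delta_2)]$. Conditions on $W:\mathbb{R}\to[0,\infty)$: (C1) $W(0)=0$, $W$ is strictly decreasing on $(-\infty,0)$ and strictly increasing on $(0,\infty)$; (C2) $W'$ is increasing almost everywhere; (C3) the integrals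 involving $W$ are finite and differentiation under the integral sign is permissible. *)

(* Defs.v *)
From HB Require Import structures.
From mathcomp Require Import all_boot all_order all_algebra.
From mathcomp Require Import all_classical all_reals all_analysis.

Set Implicit Arguments.
Unset Strict Implicit.
Unset Printing Implicit Defensive.

Import Order.TTheory GRing.Theory Num.Theory.
Import numFieldNormedType.Exports.

Local Open Scope classical_set_scope.
Local Open Scope ring_scope.

Section Model.
Context {R : realType}.
Implicit Types (f : R -> R) (theta : R * R).

Definition is_density f : Prop :=
  [/\ measurable_fun setT f, (forall x, 0 <= f x) &
      (\int[lebesgue_measure]_x (f x)%:E = 1)%E].

Definition MLR f : Prop :=
  forall x1 x2 eta1 eta2 : R, x1 < x2 -> eta1 < eta2 ->
    f (x1 - eta2) * f (x2 - eta1) <= f (x1 - eta1) * f (x2 - eta2).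

Context d (T : measurableType d).
Implicit Types (P : probability T R) (X : {mfun T >-> R}).

Definition has_density P X f : Prop :=
  forall A : set R, measurable A ->
    (P (X @^-1` A) = \int[lebesgue_measure]_(x in A) (f x)%:E)%E.

Definition independent2 P (X1 X2 : {mfun T >-> R}) : Prop :=
  forall A B : set R, measurable A -> measurable B ->
    (P (X1 @^-1` A `&` X2 @^-1` B) = P (X1 @^-1` A) * P (X2 @^-1` B))%E.

(* The observations X1, X2 are fixed; the parameter only changes their law. *)
Definition location_model f (P : R * R -> probability T R)
    (X1 X2 : {mfun T >-> R}) : Prop :=
  forall theta,
    [/\ independent2 (P theta) X1 X2,
        has_density (P theta) X1 (fun x => f (x - theta.1)) &
        has_density (P theta) X2 (fun x => f (x - theta.2))].

End Model.

Section Ordered.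
Context {R : realType}.
Implicit Types (theta : R * R) (f W : R -> R).

Definition lower (x : R * R) : R := Num.min x.1 x.2.
Definition upper (x : R * R) : R := Num.max x.1 x.2.
Definition range_of (x : R * R) : R := upper x - lower x.

(* delta_phi(x) = x_(2) - phi(u) with u = x_(2) - x_(1) >= 0, so only the
   values of phi on [0, +oo[ are used. *)
Definition delta (phi : R -> R) (x : R * R) : R := upper x - phi (range_of x).

Definition loss W theta (a : R) : R := W (a - upper theta).

(* Unnormalized conditional density of X_(2) - theta_(2) given U = u: the
   summands correspond to the observation with the larger location parameter
   being X_(2), respectively X_(1). *)
Definition cond_weight f theta (u z : R) : R :=
  f (z - u + range_of theta) * f z + f (z - u) * f (z + range_of theta).

Definition cond_density f theta (u z : R) : R :=
  cond_weight f theta u z /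
  Rintegral lebesgue_measure setT (cond_weight f theta u).

Definition cond_distr f theta (u : R) (A : set R) : \bar R :=
  (\int[lebesgue_measure]_(z in A) (cond_density f theta u z)%:E)%E.

Definition is_median (mu : set R -> \bar R) (m : R) : Prop :=
  ((2^-1)%:E <= mu `]-oo, m]%classic)%E /\ ((2^-1)%:E <= mu `[m, +oo[%classic)%E.

Definition is_unique_median (mu : set R -> \bar R) (m : R) : Prop :=
  is_median mu m /\ forall m', is_median mu m' -> m' = m.

(* m(0, u) = m u for u > 0.  This entails that the conditional distribution is
   well defined: if the total mass of cond_weight is 0 or +oo then Rintegral
   is 0, so cond_density is identically 0 and has no median. *)
Definition is_median_at_zero f (m : R -> R) : Prop :=
  forall u, 0 < u -> is_unique_median (cond_distr f (0, 0) u) (m u).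

Definition C1 W : Prop :=
  [/\ W 0 = 0,
      (forall x y, x < y -> y < 0 -> W y < W x) &
      (forall x y, 0 < x -> x < y -> W x < W y)].

Definition C2 W : Prop :=
  exists N : set R, [/\ lebesgue_measure.-negligible N,
    (forall x, ~ N x -> derivable W x 1) &
    (forall x y, ~ N x -> ~ N y -> x < y -> derive1 W x <= derive1 W y)].

(* The integrals at stake are the conditional risks of X_(2) - c given U = u,
   as functions of c. *)
Definition C3 f W : Prop :=
  forall theta (u c : R), 0 < u ->
    [/\ lebesgue_measure.-integrable setT
          (fun z => (W (z - c) * cond_density f theta u z)%:E),
        lebesgue_measure.-integrable setT
          (fun z => (derive1 W (z - c) * cond_density f theta u z)%:E) &
        is_derive c 1
          (fun b : R => Rintegral lebesgue_measure setT
             (fun z => W (z - b) * cond_density f theta u z))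
          (- Rintegral lebesgue_measure setT
             (fun z => derive1 W (z - c) * cond_density f theta u z))].

Definition GPN d (T : measurableType d) (P : probability T R)
    (X1 X2 : T -> R) W (delta1 delta2 : R * R -> R) theta : \bar R :=
  let L1 w := loss W theta (delta1 (X1 w, X2 w)) in
  let L2 w := loss W theta (delta2 (X1 w, X2 w)) in
  (P [set w | (L1 w < L2 w)%R] + (2^-1)%:E * P [set w | L1 w = L2 w])%E.

End Ordered.

(* Main.v *)
(* Put Z = X_(2) - theta_(2).  On the event phi(U) > m(0, U) the two estimators
   differ, and there Z <= m(0, U) forces the smaller correction m(0, U) to give
   the smaller loss, since W decreases on the negative half-line.  Elsewhere
   the estimators coincide, so it suffices that Z <= m(0, u) has conditional
   probability at least 1/2 given U = u for every theta.  By MLR the ratio of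
   the conditional weights for theta and for 0 is nonincreasing in z, hence the
   law for theta puts at least as much mass below m(0, u) as above it.

   Equality would make the two weights proportional.  For theta = (0, t) with
   t > u this is impossible: the support of f is an unbounded interval because
   m(0, u) exists for every u > 0, and proportionality then either contradicts
   the shape of the support or makes f periodic up to a constant factor, hence
   not integrable.  Since every u with phi(u) > m(0, u) lies below some integer
   t, the domination is strict for one of the parameters (0, t). *)
Require Import Defs.
From HB Require Import structures.
From mathcomp Require Import all_boot all_order all_algebra.
From mathcomp Require Import all_classical all_reals all_analysis.
From mathcomp Require Import measurable_realfun ring lra.

Set Implicit Arguments.
Unset Strict Implicit.
Unset Printing Implicit Defensive.

Import Order.TTheory GRing.Theory Num.Theory.
Import numFieldNormedType.Exports.

Local Open Scope classical_set_scope.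
Local Open Scope ring_scope.

(** * Translations and log-concave densities *)

Section Translation.
Context {R : realType}.
Local Notation mu := (@lebesgue_measure R).
Local Open Scope ereal_scope.

(** The push-forward of Lebesgue measure under the translation agrees with it on half-open
    intervals, hence everywhere by uniqueness. *)
Lemma ge0_integral_shift (c : R) (g : R -> \bar R) :
  measurable_fun [set: R] g -> (forall x, 0 <= g x) ->
  \int[mu]_x g (x + c)%R = \int[mu]_x g x.
Proof.
move=> mg g0.
pose phi (x : measurableTypeR R) : measurableTypeR R := (x + c)%R.
have mphi : measurable_fun setT phi by apply: measurable_funD.
pose phim : {mfun _ >-> _} := HB.pack phi (isMeasurableFun.Build _ _ _ _ _ mphi).
have E : \int[pushforward mu phi]_y g y = \int[mu]_x (g \o phi) x.
  rewrite ge0_integral_pushforward// => y; exact: g0.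
rewrite -[LHS]E; apply: eq_measure_integral => A mA _.
apply/esym.
apply: (@lebesgue_measure_unique R (pushforward mu phim)) => //= _ [[a b]] _ <-.
rewrite /pushforward/=.
have -> : phi @^-1` `]a, b] = `](a - c)%R, (b - c)%R]%classic.
  by apply/seteqP; split => x /=; rewrite /phi !in_itv/= ltrBlDr lerBrDr.
rewrite !lebesgue_measure_itv/= !lte_fin.
by rewrite ltrD2r -!EFinD; case: ifPn => // _; congr (_%:E); ring.
Qed.

(** A reflection is the negation, which preserves Lebesgue measure, combined with a translation. *)
Lemma ge0_integral_reflect (c : R) (g : R -> \bar R) :
  measurable_fun [set: R] g -> (forall x, 0 <= g x) ->
  \int[mu]_x g (c - x)%R = \int[mu]_x g x.
Proof.
move=> mg g0.
have mgc : measurable_fun [set: R] (fun x : R => g (x + c)%R).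
  by apply: measurableT_comp => //; exact: measurable_funD.
rewrite -[RHS](ge0_integral_shift c)//.
transitivity (\int[pushforward mu (-%R : _ -> measurableTypeR R)]_x g (x + c)%R).
  rewrite ge0_integral_pushforward//.
  by rewrite preimage_setT; apply: eq_integral => x _ /=; rewrite addrC.
apply/esym/eq_measure_integral => /= A mA _.
by rewrite lebesgue_measureN.
Qed.

End Translation.

(** * Rigidity: log-concave densities with proportional conditional weights *)

Section Rigidity.
Context {R : realType}.
Local Notation mu := (@lebesgue_measure R).

(** A null set cannot contain a nonempty open interval. This is how identities valid almost
    everywhere are used at concrete points below. *)
Lemma ae_itvoo (Q : R -> Prop) (a b : R) : a < b ->
  {ae mu, forall x, Q x} -> exists2 x, a < x < b & Q x.
Proof.
move=> ab [N [mN N0 QN]]; apply: contrapT => nQ.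
have sub : `]a, b[%classic `<=` N.
  move=> x /=; rewrite in_itv/= => xab; apply: QN => /= Qx.
  by apply: nQ; exists x.
have : (mu `]a, b[%classic <= mu N)%E by apply: le_measure; rewrite ?inE.
by rewrite N0 lebesgue_measure_itv/= lte_fin ab -EFinD lee_fin subr_le0 leNgt ab.
Qed.

Variable f : R -> R.
Hypotheses (f_ge0 : forall x, 0 <= f x) (f_MLR : MLR f).

(** For a location family [MLR] is log-concavity: taking [x1 = a], [x2 = q], [eta1 = a - p],
    [eta2 = 0] shows that a product with fixed sum of arguments does not decrease when the arguments
    move inward. *)
Lemma MLR_between (a b p q : R) : a < p -> a < q -> p + q = a + b ->
  f a * f b <= f p * f q.
Proof.
move=> ap aq pq.
have := @f_MLR a q (a - p) 0 aq.
rewrite subr_lt0 => /(_ ap); rewrite !subr0.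
have -> : q - (a - p) = b by lra.
by rewrite opprB addrCA subrr addr0.
Qed.

(** The support is convex: a zero at [p] would annihilate the product of the values at [p] and at
    its mirror image [a + b - p], which dominates [f a * f b]. *)
Lemma MLR_pos (a b p : R) : a < p -> p < b -> 0 < f a -> 0 < f b -> 0 < f p.
Proof.
move=> ap pb fa fb; rewrite lt_neqAle f_ge0 andbT eq_sym; apply/eqP => fp.
have := @MLR_between a b p (a + b - p) ap _ _.
rewrite fp mul0r leNgt mulr_gt0// => H.
by have : false by apply: H; lra.
Qed.

(** This is monotonicity of [f (x + t) / f x], written without division because [f] may vanish. *)
Lemma MLR_ratio (t x y : R) : 0 < t -> x < y ->
  f x * f (y + t) <= f (x + t) * f y.
Proof. by move=> t0 xy; apply: MLR_between; lra. Qed.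

(** Two-sided bounds on the support contradict a pair of support points at distance
    [|x - y| + 1]. *)
Lemma MLR_unbounded :
  (forall u, 0 < u -> exists2 z, 0 < f z & 0 < f (z - u)) ->
  (forall x, exists2 y, x < y & 0 < f y) \/
  (forall x, exists2 y, y < x & 0 < f y).
Proof.
move=> wide; apply: contrapT => /not_orP[/existsNP[x nx] /existsNP[y ny]].
have [z fz fzu] := wide (`|x - y| + 1) (ltr_pwDr ltr01 (normr_ge0 _)).
have zx : z <= x by rewrite leNgt; apply/negP => xz; apply: nx; exists z.
have zy : y <= z - (`|x - y| + 1).
  by rewrite leNgt; apply/negP => xz; apply: ny; exists (z - (`|x - y| + 1)).
have := ler_norm (x - y); lra.
Qed.

Lemma MLR_tail_right (z y : R) :
  (forall x, exists2 y, x < y & 0 < f y) -> 0 < f z -> z <= y -> 0 < f y.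
Proof.
move=> top fz; rewrite le_eqVlt => /predU1P[<-//|zy].
by have [x yx fx] := top y; exact: MLR_pos zy yx fz fx.
Qed.

Lemma MLR_tail_left (z y : R) :
  (forall x, exists2 y, y < x & 0 < f y) -> 0 < f z -> y <= z -> 0 < f y.
Proof.
move=> bot fz; rewrite le_eqVlt => /predU1P[->//|zy].
by have [x yx fx] := bot y; exact: MLR_pos yx zy fx fz.
Qed.

(** The conditional weight for a parameter with range [t]. The assumption [w_prop] below makes it
    proportional to the weight at the origin, whose factor 2 is absorbed into [k]. *)
Local Notation w t u z := (f (z - u + t) * f z + f (z - u) * f (z + t)).

Variables (t u k : R).
Hypotheses (u_gt0 : 0 < u) (ut : u < t).
Hypothesis w_prop : {ae mu, forall z, w t u z = k * (f (z - u) * f z)}.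

(* Unboundedness above makes the first summand of w positive near z, so the
   right-hand side of w_prop is positive too and the support extends to the
   left by u / 2. *)
Let step_down z : (forall x, exists2 y, x < y & 0 < f y) ->
  0 < f z -> 0 < f (z - u / 2).
Proof.
move=> top fz.
have u0 := u_gt0; have tu := ut.
have zu : z < z + u / 2 by lra.
(* Any such [y] satisfies [y - u < z - u / 2 < y], so positivity at [y - u] and [y] passes to
   [z - u / 2] by convexity of the support. *)
have [y /andP[zy yz]] := ae_itvoo zu w_prop.
have fy : 0 < f y by apply: MLR_tail_right fz (ltW zy).
have fyt : 0 < f (y - u + t) by apply: (MLR_tail_right top fz); lra.
move=> wy; have : 0 < w t u y.
  by rewrite ltr_pwDl ?mulr_gt0// mulr_ge0.
rewrite wy => kpos.
have fyu : 0 < f (y - u).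
  rewrite lt_neqAle f_ge0 andbT eq_sym; apply/eqP => fyu0.
  by move: kpos; rewrite fyu0 mul0r mulr0 ltxx.
by apply: (@MLR_pos (y - u) y) => //; lra.
Qed.

(** Iterating [step_down] reaches a support point below any given [x], and the support is closed
    upwards. *)
Let pos_everywhere z0 : (forall x, exists2 y, x < y & 0 < f y) ->
  0 < f z0 -> forall x, 0 < f x.
Proof.
have u0 := u_gt0.
move=> top fz0 x.
have down n : 0 < f (z0 - n%:R * (u / 2)).
  elim: n => [|n IH]; first by rewrite mul0r subr0.
  have := step_down top IH; congr (0 < f _).
  by rewrite -natr1; ring.
have [n] : exists n : nat, (z0 - x) / (u / 2) < n%:R.
  exists (Num.bound `|(z0 - x) / (u / 2)|).
  exact: le_lt_trans (ler_norm _) (archi_boundP (normr_ge0 _)).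
rewrite ltr_pdivrMr ?divr_gt0// => zn.
by apply: (MLR_tail_right top (down n)); lra.
Qed.

Hypotheses (f_meas : measurable_fun [set: R] f)
  (f_int : (\int[mu]_x (f x)%:E = 1)%E).

(* A positive f would satisfy f (x + t) = c f x for all x; then c = 1 since
   both sides have the same integral, and a periodic f is not integrable. *)
Let not_pos_everywhere : ~ (forall x, 0 < f x).
Proof.
move=> fpos; have u0 := u_gt0; have tu := ut.
have t_gt0 : 0 < t by lra.
pose r x := f (x + t) / f x.
have r_le (x y : R) : x <= y -> r y <= r x.
  rewrite le_eqVlt => /predU1P[->//|xy].
  by rewrite /r ler_pdivrMr// mulrAC ler_pdivlMr// mulrC MLR_ratio.
have r_sum z : w t u z = k * (f (z - u) * f z) -> r z + r (z - u) = k.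
  move=> wz; have := fpos z; have := fpos (z - u) => p1 p2.
  apply: (mulIf (lt0r_neq0 (mulr_gt0 p1 p2))).
  by rewrite -wz /r; field; rewrite !gt_eqF.
(* By [r_sum], [r z + r (z - u)] takes the same value [k] at a point left of [x] and at a point
   right of [y]. Both summands are nonincreasing, so [r] cannot drop in between. *)
have r_const (x y : R) : x < y -> r x = r y.
  move=> xy.
  have [z /andP[yz _] /r_sum rz] := ae_itvoo (ltr_pwDr ltr01 (lexx y)) w_prop.
  have x1 : x - 1 < x by rewrite gtrBl.
  have [z' /andP[_ zx] /r_sum rz'] := ae_itvoo x1 w_prop.
  have h1 := r_le z' x (ltW zx).
  have h2 := r_le x y (ltW xy).
  have h3 := r_le y z (ltW yz).
  have /r_le h4 : z' - u <= z - u by lra.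
  lra.
pose c := r 0.
have fc x : f (x + t) = c * f x.
  have <- : r x = c.
    by have [x0|x0|->//] := ltgtP x 0; [exact: r_const|exact/esym/r_const].
  by rewrite /r divfK// gt_eqF.
have mE : measurable_fun [set: R] (fun x => (f x)%:E) by exact/measurable_EFinP.
have c1 : c = 1.
  have := @ge0_integral_shift R t (fun x => (f x)%:E) mE (fun x => ltac:(by rewrite lee_fin)).
  under eq_integral do rewrite fc EFinM.
  rewrite ge0_integralZl//; [|by move=> *; rewrite lee_fin|].
    by rewrite f_int mule1 => -[].
  by rewrite lee_fin /c /r divr_ge0.
have mfI (A : set R) : measurable_fun A (fun x => (f x)%:E).
  exact: measurable_funS mE.
have fint A : measurable A -> (\int[mu]_(x in A) (f x)%:E)%E \is a fin_num.
  move=> mA; rewrite ge0_fin_numE; last by apply: integral_ge0 => *; rewrite lee_fin.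
  apply: (@le_lt_trans _ _ 1%E); last exact: ltry.
  rewrite -f_int; apply: ge0_subset_integral => //.
  by move=> *; rewrite lee_fin.
(* With [c = 1] the shift by [t] identifies the mass of []-oo, t]] with that of []-oo, 0]], so []0,
   t]] has mass 0 although [f] is positive. *)
have tail_split : (\int[mu]_(x in `]-oo, t]) (f x)%:E =
    \int[mu]_(x in `]-oo, 0%R]) (f x)%:E + \int[mu]_(x in `]0%R, t]) (f x)%:E)%E.
  have -> : `]-oo, t]%classic = `]-oo, 0] `|` `]0, t] :> set R.
    apply/seteqP; split => x /=; rewrite !in_itv/=.
      by move=> xt; case: (leP x 0) => x0; [left|right].
    by case=> [x0|/andP[]//]; lra.
  rewrite ge0_integral_setU//; [exact: mfI| |].
    by move=> *; rewrite lee_fin.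
  by apply/disj_setPS => x /= []; rewrite !in_itv/=; lra.
have tail_eq : (\int[mu]_(x in `]-oo, t]) (f x)%:E = \int[mu]_(x in `]-oo, 0%R]) (f x)%:E)%E.
  rewrite integral_mkcond -(ge0_integral_shift t)//.
  - rewrite [RHS]integral_mkcond; apply: eq_integral => x _.
    rewrite !patchE fc c1 mul1r; congr (if _ then _ else _).
    by apply/idP/idP; rewrite !inE/= !in_itv/=; lra.
  - by apply/(measurable_restrictT _ _).1.
  - by move=> x; rewrite patchE; case: ifP => // _; rewrite lee_fin.
have body0 : (\int[mu]_(x in `]0%R, t]) (f x)%:E = 0)%E.
  have := tail_split; rewrite tail_eq.
  have := fint _ (measurable_itv `]-oo, 0%R]); have := fint _ (measurable_itv `]0%R, t]).
  case: (integral _ _ _) => // a _; case: (integral _ _ _) => // b _.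
  by rewrite -EFinD => -[ab]; congr EFin; lra.
have /ae_eq_integral_abs : (\int[mu]_(x in `]0%R, t]) `|(f x)%:E| = 0)%E.
  by rewrite -[RHS]body0; apply: eq_integral => x _; rewrite gee0_abs// lee_fin.
move=> /(_ _ (mfI _)) f0.
have [x /andP[x0 xt] H] := ae_itvoo t_gt0 (f0 (measurable_itv _)).
have := H ltac:(by rewrite /= in_itv/= x0 ltW) => -[] fx.
by have := fpos x; rewrite fx ltxx.
Qed.

(* Just below the right end of the support the left-hand side of w_prop
   vanishes and the right-hand side does not, unless k = 0. *)
Let bounded_above : ~ (forall x, exists2 y, x < y & 0 < f y) ->
  (forall x, exists2 y, y < x & 0 < f y) -> False.
Proof.
have u0 := u_gt0; have tu := ut.
move=> /existsNP[b nb] bot.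
have fb y : b < y -> f y = 0.
  move=> yb; apply/eqP; rewrite eq_le f_ge0 andbT leNgt; apply/negP => fy.
  by apply: nb; exists y.
have fz0 z y : f z = 0 -> z <= y -> f y = 0.
  move=> fz zy; apply/eqP; rewrite eq_le f_ge0 andbT leNgt; apply/negP => fy.
  by have := MLR_tail_left bot fy zy; rewrite fz ltxx.
(* Without such a [c], steps of length [(t - u) / 2] from a support point would stay in the support
   and eventually pass the bound [b]. *)
have [c fc] : exists2 c, 0 < f c & f (c + (t - u) / 2) = 0.
  apply: contrapT => nc.
  have [z0 _ fz] := bot 0.
  have up n : 0 < f (z0 + n%:R * ((t - u) / 2)).
    elim: n => [|n IH]; first by rewrite mul0r addr0.
    rewrite -natr1 mulrDl mul1r addrA lt_neqAle f_ge0 andbT eq_sym.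
    by apply/eqP => H; apply: nc; exists (z0 + n%:R * ((t - u) / 2)).
  have [n] : exists n : nat, (b - z0) / ((t - u) / 2) < n%:R.
    exists (Num.bound `|(b - z0) / ((t - u) / 2)|).
    exact: le_lt_trans (ler_norm _) (archi_boundP (normr_ge0 _)).
  rewrite ltr_pdivrMr ?divr_gt0 ?subr_gt0// => zn.
  have := up n; rewrite fb ?ltxx//; lra.
move=> fct.
have c1 : c - (t - u) / 2 < c by lra.
(* For [z] this close to [c], both [z - u + t] and [z + t] lie beyond the zero at
   [c + (t - u) / 2]. *)
have [z /andP[zc cz] wz] := ae_itvoo c1 w_prop.
have fz : 0 < f z by exact: MLR_tail_left bot fc (ltW cz).
have fzu : 0 < f (z - u) by apply: (MLR_tail_left bot fz); lra.
have k0 : k = 0.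
  move: wz; rewrite (fz0 _ (z - u + t) fct) ?(fz0 _ (z + t) fct); [|lra|lra].
  rewrite mul0r mulr0 addr0 => /esym/eqP; rewrite mulf_eq0 => /orP[/eqP//|].
  by rewrite gt_eqF// mulr_gt0.
(* Left of [c - t] the first summand of [w] is positive, which excludes [k = 0]. *)
have c2 : c - t - 1 < c - t by lra.
have [y /andP[_ yc]] := ae_itvoo c2 w_prop.
rewrite k0 mul0r => wy.
have : 0 < w t u y.
  rewrite ltr_pwDl ?mulr_gt0 ?mulr_ge0//; apply: (MLR_tail_left bot fc); lra.
by rewrite wy ltxx.
Qed.

(** The support is unbounded on some side. Unboundedness above forces an everywhere positive [f];
    otherwise the support is bounded above and unbounded below. Both cases are excluded already. *)
Lemma MLR_not_proportional :
  ~ (forall v, 0 < v -> exists2 z, 0 < f z & 0 < f (z - v)).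
Proof.
move=> wide.
have [top|bot] := MLR_unbounded wide.
  have [z0 _ fz0] := top 0.
  exact/not_pos_everywhere/(pos_everywhere top fz0).
have [top|ntop] := pselect (forall x, exists2 y, x < y & 0 < f y).
  have [z0 _ fz0] := top 0.
  exact/not_pos_everywhere/(pos_everywhere top fz0).
exact: bounded_above.
Qed.

End Rigidity.

(** * Medians and monotone likelihood ratios *)

Section HalfLines.
Context {R : realType}.
Local Notation mu := (@lebesgue_measure R).
Implicit Types g : R -> R.
Local Open Scope ereal_scope.

Lemma integral_split g c : measurable_fun [set: R] g -> (forall x, 0 <= g x)%R ->
  \int[mu]_x (g x)%:E =
    \int[mu]_(x in `]-oo, c]) (g x)%:E + \int[mu]_(x in `]c, +oo[) (g x)%:E.
Proof.
move=> mg g0.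
have -> : [set: R] = `]-oo, c] `|` `]c, +oo[.
  apply/seteqP; split => x //= _; rewrite !in_itv/= andbT.
  by case: (leP x c) => xc; [left|right].
have mE (A : set R) : measurable_fun A (fun x => (g x)%:E).
  by apply/measurable_EFinP; exact: measurable_funS mg.
rewrite ge0_integral_setU//; [exact: mE| |].
  by move=> *; rewrite lee_fin.
by apply/disj_setPS => x /= []; rewrite !in_itv/= andbT; lra.
Qed.

Lemma ge0_integral_EFinM (A : set R) g (c : R) : measurable A ->
  measurable_fun [set: R] g -> (forall x, 0 <= g x)%R -> (0 <= c)%R ->
  \int[mu]_(x in A) (c * g x)%:E = c%:E * \int[mu]_(x in A) (g x)%:E.
Proof.
move=> mA mg g0 c0; under eq_integral do rewrite EFinM.
rewrite ge0_integralZl//.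
  by apply/measurable_EFinP; exact: measurable_funS mg.
by move=> x _; rewrite lee_fin.
Qed.

(** Uniqueness enters in the last clause: a point below [m] with at least half of the mass on its
    left would be a second median. The clause describes [m <= c] through integrals with [c] fixed,
    which later yields measurability of the median. *)
Lemma unique_median_halves g m :
  measurable_fun [set: R] g -> (forall x, 0 <= g x)%R ->
  is_unique_median
    (fun A => \int[mu]_(x in A) (g x / Rintegral mu setT g)%:E) m ->
  exists2 k : R, (0 < k)%R &
    [/\ \int[mu]_(x in `]-oo, m]) (g x)%:E = k%:E,
        \int[mu]_(x in `]m, +oo[) (g x)%:E = k%:E &
        forall c : R, (m <= c)%R <->
          \int[mu]_(x in `]c, +oo[) (g x)%:E <=
          \int[mu]_(x in `]-oo, c]) (g x)%:E].
Proof.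
move=> mg g0.
have gE0 (A : set R) x : A x -> 0 <= (g x)%:E by rewrite lee_fin.
have I0 (A : set R) : 0 <= \int[mu]_(x in A) (g x)%:E by apply: integral_ge0; exact: gE0.
have mE (A : set R) : measurable_fun A (fun x => (g x)%:E).
  by apply/measurable_EFinP; exact: measurable_funS mg.
set K := Rintegral mu setT g => -[[m1 m2] m_uniq].
have K_ge0 : (0 <= K)%R by apply: fine_ge0; exact: I0.
(* [Rintegral] is 0 also when the integral is infinite, so [K > 0] makes the total mass both nonzero
   and finite. *)
have K_gt0 : (0 < K)%R.
  rewrite lt_neqAle K_ge0 andbT eq_sym; apply/eqP => K0.
  move: m1; rewrite K0; under eq_integral do rewrite invr0 mulr0.
  by rewrite integral0 lee_fin leNgt invr_gt0 ltr0n.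
have KE : \int[mu]_x (g x)%:E = K%:E.
  rewrite /K /Rintegral fineK// ge0_fin_numE ?I0// ltey.
  by apply/eqP => gy; move: K_gt0; rewrite /K /Rintegral gy ltxx.
have scale (A : set R) : measurable A ->
    \int[mu]_(x in A) (g x / K)%:E = (K^-1)%:E * \int[mu]_(x in A) (g x)%:E.
  move=> mA; under eq_integral do rewrite mulrC.
  by rewrite ge0_integral_EFinM// invr_ge0.
pose a c := fine (\int[mu]_(x in `]-oo, c]) (g x)%:E).
pose b c := fine (\int[mu]_(x in `]c, +oo[) (g x)%:E).
have fin (A : set R) : measurable A -> \int[mu]_(x in A) (g x)%:E \is a fin_num.
  move=> mA; rewrite ge0_fin_numE ?I0//.
  rewrite (@le_lt_trans _ _ K%:E) ?ltry// -KE.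
  by apply: ge0_subset_integral => //; [exact: mE|exact: gE0].
have aE c : \int[mu]_(x in `]-oo, c]) (g x)%:E = (a c)%:E by rewrite fineK//; exact: fin.
have bE c : \int[mu]_(x in `]c, +oo[) (g x)%:E = (b c)%:E by rewrite fineK//; exact: fin.
have abK c : (a c + b c = K)%R.
  by apply: EFin_inj; rewrite EFinD -aE -bE -integral_split.
have le_a c : (2^-1)%:E <= \int[mu]_(x in `]-oo, c]) (g x / K)%:E <-> (K / 2 <= a c)%R.
  by rewrite scale// aE lee_fin -(ler_pM2l K_gt0) mulrA divff ?gt_eqF// mul1r.
have le_b c : (2^-1)%:E <= \int[mu]_(x in `[c, +oo[) (g x / K)%:E <-> (K / 2 <= b c)%R.
  (* Points have Lebesgue measure zero, so the closed and the open half-line carry the same mass. *)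
  rewrite scale// -integral_itv_obnd_cbnd; last exact: mE.
  by rewrite bE lee_fin -(ler_pM2l K_gt0) mulrA divff ?gt_eqF// mul1r.
have a_mono x y : (x <= y)%R -> (a x <= a y)%R.
  move=> xy; rewrite -lee_fin -!aE; apply: ge0_subset_integral => //; [exact: mE|exact: gE0|].
  by move=> z /=; rewrite !in_itv/= => /le_trans; exact.
move: m1 m2 => /le_a am /le_b bm.
have abm := abK m.
exists (K / 2)%R; first by lra.
split.
- by rewrite aE; congr EFin; lra.
- by rewrite bE; congr EFin; lra.
move=> c; rewrite aE bE lee_fin; have abc := abK c; split => [mc|bac].
  by have := a_mono m c mc; lra.
rewrite leNgt; apply/negP => cm.
have acm := a_mono c m (ltW cm).
suff cE : c = m by move: cm; rewrite cE ltxx.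
by apply: m_uniq; split; [apply/le_a|apply/le_b]; lra.
Qed.

End HalfLines.

(** * Comparison of two weights whose ratio is monotone *)

Section RatioComparison.
Context {R : realType}.
Local Notation mu := (@lebesgue_measure R).
Variables (g h : R -> R) (m k : R).
Hypotheses (mg : measurable_fun [set: R] g) (mh : measurable_fun [set: R] h)
  (g0 : forall x, 0 <= g x) (h0 : forall x, 0 <= h x)
  (ratio : forall x y, x <= y -> h y * g x <= h x * g y)
  (k_gt0 : 0 < k)
  (g_lo : (\int[mu]_(x in `]-oo, m]) (g x)%:E = k%:E)%E)
  (g_up : (\int[mu]_(x in `]m, +oo[) (g x)%:E = k%:E)%E).
Local Open Scope ereal_scope.

Local Notation lo := (\int[mu]_(x in `]-oo, m]) (h x)%:E).
Local Notation up := (\int[mu]_(x in `]m, +oo[) (h x)%:E).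

Let int_le (A : set R) (p q : R -> R) (a b : R) : measurable A ->
  measurable_fun [set: R] p -> measurable_fun [set: R] q ->
  (forall x, 0 <= p x)%R -> (forall x, 0 <= q x)%R ->
  (0 <= a)%R -> (0 <= b)%R -> (forall x, A x -> a * p x <= b * q x)%R ->
  a%:E * \int[mu]_(x in A) (p x)%:E <= b%:E * \int[mu]_(x in A) (q x)%:E.
Proof.
move=> mA mp mq p0 q0 a0 b0 le_pq.
rewrite -!ge0_integral_EFinM//; apply: ge0_le_integral => //.
- by move=> x _; rewrite lee_fin mulr_ge0.
- by apply/measurable_EFinP/measurable_funM => //; exact: measurable_funS mp.
- by apply/measurable_EFinP/measurable_funM => //; exact: measurable_funS mq.
Qed.

(** Integrate [ratio] over [x <= m] with [y] fixed; [le_left] integrates over [y > m] with [x] fixed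
    instead. *)
Let le_right (i y : R) : lo = i%:E -> (m < y)%R -> (k * h y <= i * g y)%R.
Proof.
move=> loE my; rewrite -lee_fin !EFinM -loE -g_lo ![_ * (_ y)%:E]muleC.
apply: int_le => // x; rewrite /= in_itv/= => xm.
by rewrite [leRHS]mulrC; apply: ratio; rewrite (le_trans xm) ?ltW.
Qed.

Let le_left (i x : R) : up = i%:E -> (x <= m)%R -> (i * g x <= k * h x)%R.
Proof.
move=> upE xm; rewrite -lee_fin !EFinM -upE -g_up ![_ * (_ x)%:E]muleC.
apply: int_le => // y; rewrite /= in_itv/= andbT => my.
by rewrite mulrC; apply: ratio; rewrite (le_trans xm) ?ltW.
Qed.

Let lo_ge0 : 0 <= lo. Proof. by apply: integral_ge0 => x _; rewrite lee_fin. Qed.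
Let up_ge0 : 0 <= up. Proof. by apply: integral_ge0 => x _; rewrite lee_fin. Qed.

(** Integrating [le_right] over [y > m] gives [k * up <= lo * k], and [k] cancels; an infinite [lo]
    is trivial. *)
Lemma upper_le_lower : up <= lo.
Proof.
case loE : lo lo_ge0 => [i| |]//= i0; last by rewrite leey.
have : k%:E * up <= i%:E * k%:E.
  rewrite -[in leRHS]g_up; apply: int_le => //; [exact: ltW|].
  by move=> x; rewrite /= in_itv/= andbT; exact: le_right.
by rewrite muleC lee_pmul2r.
Qed.

(** A difference of constant sign with zero integral vanishes almost everywhere. The disjunction is
    there because the two half-lines give inequalities in opposite directions. *)
Let ae_prop (A : set R) (i : R) : measurable A ->
  \int[mu]_(x in A) (h x)%:E = i%:E -> \int[mu]_(x in A) (g x)%:E = k%:E ->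
  (forall x, A x -> k * h x <= i * g x)%R \/
  (forall x, A x -> i * g x <= k * h x)%R ->
  {ae mu, forall x, A x -> h x = i / k * g x}%R.
Proof.
move=> mA hi gi.
have i0 : (0 <= i)%R.
  by rewrite -lee_fin -hi; apply: integral_ge0 => x _; rewrite lee_fin.
have kh0 x : (0 <= k * h x)%R by rewrite mulr_ge0// ltW.
have mEg : measurable_fun A (fun x => (i * g x)%:E).
  by apply/measurable_EFinP/measurable_funM => //; exact: measurable_funS mg.
have mEh : measurable_fun A (fun x => (k * h x)%:E).
  by apply/measurable_EFinP/measurable_funM => //; exact: measurable_funS mh.
have intg : \int[mu]_(x in A) (i * g x)%:E = (i * k)%:E.
  by rewrite ge0_integral_EFinM// gi.
have inth : \int[mu]_(x in A) (k * h x)%:E = (i * k)%:E.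
  by rewrite ge0_integral_EFinM ?ltW// hi mulrC.
have Ig : mu.-integrable A (fun x => (i * g x)%:E).
  apply/integrableP; split => //.
  under eq_integral do rewrite gee0_abs ?lee_fin ?mulr_ge0//.
  by rewrite intg ltry.
have Ih : mu.-integrable A (fun x => (k * h x)%:E).
  apply/integrableP; split => //.
  under eq_integral do rewrite gee0_abs ?lee_fin ?kh0//.
  by rewrite inth ltry.
have diff : \int[mu]_(x in A) (i * g x - k * h x)%:E = 0.
  by rewrite integralB_EFin// intg inth subee.
have mD : measurable_fun A (fun x => (i * g x - k * h x)%:E).
  by apply/measurable_EFinP/measurable_funB; exact/measurable_EFinP.
move=> sgn.
have /(ae_eq_integral_abs mu mA mD).1 : \int[mu]_(x in A) `|(i * g x - k * h x)%:E| = 0.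
  case: sgn => le.
    rewrite -diff; apply: eq_integral => x /set_mem Ax.
    by rewrite gee0_abs// lee_fin subr_ge0 le.
  transitivity (\int[mu]_(x in A) ((k * h x)%:E - (i * g x)%:E)).
    apply: eq_integral => x /set_mem Ax.
    by rewrite lee0_abs ?lee_fin ?subr_le0 ?le// -EFinN opprB EFinB.
  by rewrite integralB_EFin// intg inth subee.
apply: filterS => x /[swap] Ax /(_ Ax) [] /eqP; rewrite subr_eq0 => /eqP E.
by apply: (mulfI (lt0r_neq0 k_gt0)); rewrite -E; field; rewrite gt_eqF.
Qed.

(** The half-lines carry equal masses of [h] and equal masses [k] of [g], so the two proportionality
    constants coincide. *)
Lemma lower_eq_upper_ae : lo <= up -> up < +oo ->
  exists c : R, {ae mu, forall x, h x = c * g x}%R.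
Proof.
move=> lou upfin.
have upE : up = (fine up)%:E by rewrite fineK// ge0_fin_numE.
have loE : lo = (fine up)%:E.
  by rewrite -upE; apply/eqP; rewrite eq_le lou upper_le_lower.
exists (fine up / k)%R.
have ael := ae_prop (measurable_itv `]-oo, m]) loE g_lo.
have aer := ae_prop (measurable_itv `]m, +oo[) upE g_up.
have {}ael : {ae mu, forall x, x \in `]-oo, m] -> h x = fine up / k * g x}%R.
  by apply: ael; right => x; rewrite /= in_itv/=; exact: le_left.
have {}aer : {ae mu, forall x, x \in `]m, +oo[ -> h x = fine up / k * g x}%R.
  by apply: aer; left => x; rewrite /= in_itv/= andbT; exact: le_right.
have FF := ae_filter_ringOfSetsType mu.
apply: (filterS2 _ _ ael aer) => x; rewrite !in_itv/= andbT.
by case: (leP x m) => xm h1 h2; [exact: h1|exact: h2].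
Qed.


End RatioComparison.

(** * The joint law of the range and the maximum *)

Section JointDensity.
Context {R : realType} d (T : measurableType d) (P : probability T R)
  (X1 X2 : {mfun T >-> R}) (f1 f2 : R -> R).
Local Notation mu := (@lebesgue_measure R).
Hypotheses (mf1 : measurable_fun [set: R] f1) (mf2 : measurable_fun [set: R] f2)
  (f10 : forall x, 0 <= f1 x) (f20 : forall x, 0 <= f2 x)
  (indep : independent2 P X1 X2)
  (dX1 : has_density P X1 f1) (dX2 : has_density P X2 f2).
Local Open Scope ereal_scope.

Let F (x : R * R) : \bar R := (f1 x.1 * f2 x.2)%:E.

Let mF : measurable_fun [set: R * R] F.
Proof.
by apply/measurable_EFinP/measurable_funM; apply: measurableT_comp.
Qed.

Let F0 x : 0 <= F x.
Proof. by rewrite lee_fin mulr_ge0. Qed.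

Let X (w : T) : R * R := (X1 w, X2 w).

Let mX : measurable_fun [set: T] X.
Proof. by apply/measurable_fun_pairP. Qed.

Let nu (A : set (R * R)) : \bar R := \int[mu \x mu]_(x in A) F x.

Let nu0 : nu set0 = 0. Proof. by rewrite /nu integral_set0. Qed.

Let nu_ge0 A : 0 <= nu A.
Proof. by apply: integral_ge0. Qed.

Let nu_sigma_additive : semi_sigma_additive nu.
Proof. exact: (@semi_sigma_additive_nng_induced _ _ _ (mu \x mu) F mF F0). Qed.

Let nu_rect (A B : set R) : measurable A -> measurable B ->
  nu (A `*` B) = P (X1 @^-1` A) * P (X2 @^-1` B).
Proof.
move=> mA mB; rewrite /nu integral_mkcond fubini_tonelli1/=; last 2 first.
- apply/(measurable_restrictT _ _).1; first exact: measurableX.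
  exact: measurable_funS mF.
- by move=> x; rewrite patchE; case: ifP.
rewrite (dX1 mA) (dX2 mB) /fubini_F/=.
transitivity (\int[mu]_x (((EFin \o f1) \_ A) x * \int[mu]_(y in B) (f2 y)%:E)).
  apply: eq_integral => x _; rewrite [in RHS]integral_mkcond -ge0_integralZl//.
  - apply: eq_integral => y _; rewrite !patchE in_setX/=.
    rewrite /F/=; case: (x \in A); case: (y \in B) => /=; rewrite ?mul0e ?mule0 -?EFinM//.
  - apply/(measurable_restrictT _ _).1 => //.
    by apply/measurable_EFinP; exact: measurable_funS mf2.
  - by move=> y _; rewrite patchE; case: ifP => // _; rewrite lee_fin.
  - by rewrite patchE; case: ifP => // _; rewrite lee_fin.
rewrite ge0_integralZr//.
- by rewrite -integral_mkcond.
- apply/(measurable_restrictT _ _).1 => //.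
  by apply/measurable_EFinP; exact: measurable_funS mf1.
- by move=> y _; rewrite patchE; case: ifP => // _; rewrite lee_fin.
- by apply: integral_ge0 => y _; rewrite lee_fin.
Qed.

(** Both sides are measures in [A] that agree on rectangles by independence and Tonelli; rectangles
    are stable under intersection and generate the product sigma-algebra. *)
Lemma joint_density (A : set (R * R)) : measurable A ->
  P ((fun w => (X1 w, X2 w)) @^-1` A) = \int[mu \x mu]_(x in A) (f1 x.1 * f2 x.2)%:E.
Proof.
move=> mA; rewrite -[RHS]/(nu A) -[LHS]/(pushforward P X A).
pose Xm : {mfun _ >-> _} := HB.pack X (isMeasurableFun.Build _ _ _ _ _ mX).
pose num : {measure set (R * R) -> \bar R} :=
  HB.pack nu (isMeasure.Build _ _ _ nu nu0 nu_ge0 nu_sigma_additive).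
pose G : set (set (R * R)) :=
  [set C | exists A, measurable A /\ exists B, measurable B /\ C = A `*` B].
have GI : setI_closed G.
  move=> /= _ _ [A1 [mA1 [A2 [mA2 ->]]]] [B1 [mB1 [B2 [mB2 ->]]]].
  rewrite -setXI; exists (A1 `&` B1); split; first exact: measurableI.
  by exists (A2 `&` B2); split => //; exact: measurableI.
apply: (measure_unique G (fun _ => setT) _ _ _ _ (pushforward P Xm) num) => //.
- rewrite measurable_prod_measurableType //; congr (<<s _ >>).
  rewrite predeqE => C; split => [[B1 mB1 [B2 mB2 <-]]|[B1 [mB1 [B2 [mB2 ->]]]]].
    by exists B1; split => //; exists B2.
  by exists B1 => //; exists B2.
- by move=> _; exists setT; split => //; exists setT; split => //; rewrite setXTT.
- by rewrite bigcup_const.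
- move=> _ [B1 [mB1 [B2 [mB2 ->]]]].
  by transitivity (P (X1 @^-1` B1) * P (X2 @^-1` B2)); [rewrite -indep|exact/esym/nu_rect].
- by move=> _; rewrite /= /pushforward preimage_setT probability_setT ltry.
Qed.

End JointDensity.

(** * Linear changes of variables in the plane *)

Section ChangeOfVariables.
Context {R : realType}.
Local Notation mu := (@lebesgue_measure R).
Local Open Scope ereal_scope.
Implicit Types k : R * R -> \bar R.

(** The substitution by [u = x1 - x2] and [z = x1 - c] has unit Jacobian. It is obtained from
    one-dimensional facts: reflect the inner variable, exchange the integrals, then translate. *)
Lemma ge0_integral_shear (c : R) k :
  measurable_fun [set: R * R] k -> (forall x, 0 <= k x) ->
  \int[mu \x mu]_x k x = \int[mu \x mu]_p k (p.2 + c, p.2 + c - p.1)%R.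
Proof.
move=> mk k0.
have mk1 : measurable_fun [set: R * R] (fun p : R * R => k (p.1, p.1 - p.2)%R).
  by apply: measurableT_comp => //; apply: measurable_fun_pair => //; apply: measurable_funB.
have mk2 : measurable_fun [set: R * R] (fun p : R * R => k (p.2 + c, p.2 + c - p.1)%R).
  have m2 : measurable_fun [set: R * R] (fun p : R * R => p.2 + c)%R.
    exact: measurable_funD.
  by apply: measurableT_comp => //; apply: measurable_fun_pair => //; apply: measurable_funB.
rewrite fubini_tonelli1// [RHS]fubini_tonelli1// /fubini_F/=.
transitivity (\int[mu]_x \int[mu]_y k (x, x - y)%R).
  apply: eq_integral => x _; rewrite (ge0_integral_reflect x (g := fun y => k (x, y)))//.
  exact: measurableT_comp.
transitivity (\int[mu]_u \int[mu]_x k (x, x - u)%R).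
  exact: (@fubini_tonelli _ _ _ _ R mu mu (fun p : R * R => k (p.1, p.1 - p.2)%R)
    mk1 (fun=> k0 _)).
apply: eq_integral => u _.
rewrite (ge0_integral_shift c (g := fun x => k (x, x - u)%R))//.
by apply: measurableT_comp => //; apply: measurable_fun_pair => //; apply: measurable_funB.
Qed.

Lemma ge0_integral_swap k :
  measurable_fun [set: R * R] k -> (forall x, 0 <= k x) ->
  \int[mu \x mu]_x k x = \int[mu \x mu]_x k (x.2, x.1).
Proof.
move=> mk k0; rewrite fubini_tonelli1//.
have ms : measurable_fun [set: R * R] (fun x : R * R => k (x.2, x.1)).
  by apply: measurableT_comp => //; exact: measurable_fun_pair.
by rewrite fubini_tonelli2.
Qed.

Lemma integral_section (B : set (R * R)) k : measurable B ->
  measurable_fun [set: R * R] k -> (forall x, 0 <= k x) ->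
  \int[mu \x mu]_(x in B) k x = \int[mu]_u \int[mu]_(z in [set z | B (u, z)]) k (u, z).
Proof.
move=> mB mk k0; rewrite integral_mkcond fubini_tonelli1//.
- rewrite /fubini_F; apply: eq_integral => u _; rewrite [RHS]integral_mkcond.
  apply: eq_integral => z _; rewrite !patchE.
  have -> // : ((u, z) \in B) = (z \in [set z | B (u, z)]).
  by apply/idP/idP; rewrite !inE.
- by apply/(measurable_restrictT _ _).1 => //; exact: measurable_funS mk.
- by move=> x; rewrite patchE; case: ifP.
Qed.

End ChangeOfVariables.

(** * The density of the range and the centred maximum *)

Section RangeLaw.
Context {R : realType} d (T : measurableType d) (P : probability T R)
  (X1 X2 : {mfun T >-> R}) (f : R -> R) (theta : R * R).
Local Notation mu := (@lebesgue_measure R).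
Hypotheses (mf : measurable_fun [set: R] f) (f0 : forall x, 0 <= f x)
  (indep : independent2 P X1 X2)
  (dX1 : has_density P X1 (fun x => f (x - theta.1)))
  (dX2 : has_density P X2 (fun x => f (x - theta.2))).
Local Open Scope ereal_scope.

Lemma measurable_cond_weight :
  measurable_fun [set: R * R] (fun p : R * R => cond_weight f theta p.1 p.2).
Proof.
have md : measurable_fun [set: R * R] (fun p : R * R => p.2 - p.1)%R.
  exact: measurable_funB.
apply: measurable_funD; apply: measurable_funM; apply: measurableT_comp => //;
  exact: measurable_funD.
Qed.

Lemma cond_weight_ge0 u z : (0 <= cond_weight f theta u z)%R.
Proof. by rewrite addr_ge0 ?mulr_ge0. Qed.

(** The plane off the diagonal splits according to which observation is the maximum; on each piece
    the coordinates range and centred maximum turn the joint density into one summand of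
    [cond_weight]. *)
Lemma range_law (B : set (R * R)) : measurable B ->
  P [set w | (0 < range_of (X1 w, X2 w))%R /\
     B (range_of (X1 w, X2 w), upper (X1 w, X2 w) - upper theta)%R] =
  \int[mu \x mu]_(p in [set p | (0 < p.1)%R /\ B p])
    (cond_weight f theta p.1 p.2)%:E.
Proof.
move=> mB; pose b := upper theta.
pose A1 := [set x : R * R | (x.1 < x.2)%R /\ B (x.2 - x.1, x.2 - b)%R].
pose A2 := [set x : R * R | (x.2 < x.1)%R /\ B (x.1 - x.2, x.1 - b)%R].
pose B' := [set p : R * R | (0 < p.1)%R /\ B p].
have mshift (r : R) : measurable_fun [set: R] (fun x => f (x - r)%R).
  by apply: measurableT_comp => //; exact: measurable_funB.
have mlt (g h : R * R -> R) : measurable_fun setT g -> measurable_fun setT h ->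
    measurable [set x | (g x < h x)%R].
  move=> mg mh; rewrite -[X in measurable X]setTI.
  by apply: (measurable_fun_ltr mg mh measurableT (Y := [set true])).
have mpre (g h : R * R -> R) : measurable_fun setT g -> measurable_fun setT h ->
    measurable [set x | B (g x, h x)].
  move=> mg mh; rewrite -[X in measurable X]setTI.
  exact: (measurable_fun_pair mg mh measurableT mB).
have mA1 : measurable A1.
  apply: measurableI; first exact: mlt.
  by apply: mpre; apply: measurable_funB.
have mA2 : measurable A2.
  apply: measurableI; first exact: mlt.
  by apply: mpre; apply: measurable_funB.
have mB' : measurable B' by apply: measurableI => //; exact: mlt.
have -> : [set w | (0 < range_of (X1 w, X2 w))%R /\
     B (range_of (X1 w, X2 w), upper (X1 w, X2 w) - b)%R] =
   (fun w => (X1 w, X2 w)) @^-1` (A1 `|` A2).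
  apply/seteqP; split => w /=; rewrite /A1 /A2 /range_of /upper /lower/=.
    case: (ltgtP (X1 w) (X2 w)) => [lt|gt|->] [].
    - by move=> _ Bw; left.
    - by move=> _ Bw; right.
    - by rewrite subrr ltxx.
  case: (ltgtP (X1 w) (X2 w)) => [lt|gt|_] [] [] // _ Bw.
    by rewrite subr_gt0.
  by rewrite subr_gt0.
rewrite (joint_density _ _ _ _ indep dX1 dX2)//; last exact: measurableU.
set F := fun x : R * R => (f (x.1 - theta.1) * f (x.2 - theta.2))%:E.
have mF : measurable_fun [set: R * R] F.
  apply/measurable_EFinP/measurable_funM; apply: measurableT_comp => //;
    exact: measurable_funB.
have F0 x : 0 <= F x by rewrite lee_fin mulr_ge0.
rewrite ge0_integral_setU//; last 3 first.
- exact: measurable_funS mF.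
- by move=> x _; exact: F0.
- by apply/disj_setPS => x [[/= x1 _] [/= x2 _]]; have := lt_trans x1 x2; rewrite ltxx.
have FA0 A x : 0 <= (F \_ A) x by rewrite patchE; case: ifP.
have mFA A : measurable A -> measurable_fun setT (F \_ A).
  by move=> mA; apply/(measurable_restrictT _ _).1 => //; exact: measurable_funS mF.
(* On [A1] the maximum is the second coordinate, so the coordinates are exchanged before the
   shear. *)
have I1 : \int[mu \x mu]_(x in A1) F x =
    \int[mu \x mu]_(p in B') F (p.2 + b - p.1, p.2 + b)%R.
  rewrite integral_mkcond (ge0_integral_swap (mFA _ mA1) (FA0 A1)).
  have ms : measurable_fun [set: R * R] (fun x : R * R => (F \_ A1) (x.2, x.1)).
    by apply: measurableT_comp; [exact: mFA|exact: measurable_fun_pair].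
  rewrite (ge0_integral_shear b ms (fun x => FA0 _ _)) [RHS]integral_mkcond.
  apply: eq_integral => p _; rewrite !patchE/=.
  have -> // : ((p.2 + b - p.1, p.2 + b)%R \in A1) = (p \in B').
  apply/idP/idP; rewrite !inE /A1 /B'/= ltrBlDr ltrDl subKr addrK;
    by rewrite -surjective_pairing.
have I2 : \int[mu \x mu]_(x in A2) F x =
    \int[mu \x mu]_(p in B') F (p.2 + b, p.2 + b - p.1)%R.
  rewrite integral_mkcond (ge0_integral_shear b (mFA _ mA2) (FA0 A2)).
  rewrite [RHS]integral_mkcond.
  apply: eq_integral => p _; rewrite !patchE/=.
  have -> // : ((p.2 + b, p.2 + b - p.1)%R \in A2) = (p \in B').
  apply/idP/idP; rewrite !inE /A2 /B'/= ltrBlDr ltrDl subKr addrK;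
    by rewrite -surjective_pairing.
have m2 : measurable_fun [set: R * R] (fun p : R * R => p.2 + b)%R.
  exact: measurable_funD.
have m21 : measurable_fun [set: R * R] (fun p : R * R => p.2 + b - p.1)%R.
  exact: measurable_funB.
rewrite I1 I2 -ge0_integralD//; last 2 first.
- apply: (measurable_funS measurableT) => //.
  by apply: (measurableT_comp mF); exact: measurable_fun_pair.
- apply: (measurable_funS measurableT) => //.
  by apply: (measurableT_comp mF); exact: measurable_fun_pair.
apply: eq_integral => p _; rewrite /F /cond_weight -EFinD; congr EFin.
rewrite /b /upper /range_of /upper /lower/=.
(* The order of the parameters decides which region yields which summand of [cond_weight]. *)
case: (leP theta.1 theta.2) => th.
- have -> : (p.2 + theta.2 - p.1 - theta.1 = p.2 - p.1 + (theta.2 - theta.1))%R by ring.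
  have -> : (p.2 + theta.2 - theta.2 = p.2)%R by ring.
  have -> : (p.2 + theta.2 - theta.1 = p.2 + (theta.2 - theta.1))%R by ring.
  have -> : (p.2 + theta.2 - p.1 - theta.2 = p.2 - p.1)%R by ring.
  by ring.
- have -> : (p.2 + theta.1 - p.1 - theta.2 = p.2 - p.1 + (theta.1 - theta.2))%R by ring.
  have -> : (p.2 + theta.1 - theta.1 = p.2)%R by ring.
  have -> : (p.2 + theta.1 - theta.2 = p.2 + (theta.1 - theta.2))%R by ring.
  have -> : (p.2 + theta.1 - p.1 - theta.1 = p.2 - p.1)%R by ring.
  by ring.
Qed.

End RangeLaw.

(** * Measurability of losses and sections, and equality of integrals *)

Section Measurability.
Context {R : realType}.
Local Notation mu := (@lebesgue_measure R).

(** [C1] compares values on the open half-line only, hence the intermediate point [x / 2] rather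
    than 0. *)
Lemma C1_pos (W : R -> R) : (forall x, 0 <= W x) -> C1 W -> forall x, x < 0 -> 0 < W x.
Proof.
move=> W0 [_ Wn _] x x0; apply: (le_lt_trans (W0 (x / 2))).
by apply: Wn; lra.
Qed.

(** Each half of [W], extended by 0, is monotone on the whole line because [W] is nonnegative. *)
Lemma C1_measurable (W : R -> R) : (forall x, 0 <= W x) -> C1 W ->
  measurable_fun [set: R] W.
Proof.
move=> W0 WC1; have [W00 Wn Wp] := WC1.
have -> : W = (fun x => (if x < 0 then W x else 0) + (if 0 < x then W x else 0)).
  by apply/funext => x; case: (ltgtP x 0) => [||->]; rewrite ?addr0 ?add0r.
apply: measurable_funD.
- apply: nonincreasing_measurable => // x y; rewrite le_eqVlt => /predU1P[->//|xy].
  case: (ltP y 0) => y0; last by case: ifP.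
  by rewrite (lt_trans xy y0) ltW// Wn.
- apply: nondecreasing_measurable => // x y; rewrite le_eqVlt => /predU1P[->//|xy].
  case: (ltP 0 x) => x0; last by case: ifP.
  by rewrite (lt_trans x0 xy) ltW// Wp.
Qed.

Lemma measurable_lt_set d (T : measurableType d) (g h : T -> R) :
  measurable_fun setT g -> measurable_fun setT h -> measurable [set x | g x < h x].
Proof.
move=> mg mh; rewrite -[X in measurable X]setTI.
exact: (measurable_fun_ltr mg mh measurableT (Y := [set true])).
Qed.

Lemma measurable_eq_set d (T : measurableType d) (g h : T -> R) :
  measurable_fun setT g -> measurable_fun setT h -> measurable [set x | g x = h x].
Proof.
move=> mg mh; rewrite -[X in measurable X]setTI.
have := measurable_fun_eqr mg mh measurableT (Y := [set true]) I.
by congr (measurable (_ `&` _)); apply/seteqP; split => x /= /eqP.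
Qed.

Lemma measurable_section_integral (B : set (R * R)) (k : R * R -> \bar R) :
  measurable B -> measurable_fun [set: R * R] k -> (forall x, (0 <= k x)%E) ->
  measurable_fun [set: R]
    (fun u => \int[mu]_(z in [set z | B (u, z)]) k (u, z))%E.
Proof.
move=> mB mk k0.
rewrite (_ : (fun u => _) = fubini_F mu (k \_ B)).
  apply: measurable_fun_fubini_tonelli_F.
  - by apply/(measurable_restrictT _ _).1 => //; exact: measurable_funS mk.
  - by move=> x; rewrite patchE; case: ifP.
apply/funext => u; rewrite /fubini_F [LHS]integral_mkcond.
apply: eq_integral => z _; rewrite !patchE.
have -> // : ((u, z) \in B) = (z \in [set z | B (u, z)]).
by apply/idP/idP; rewrite !inE.
Qed.

(** The difference [h - g] is nonnegative with zero integral. Finiteness of [g x] is part of the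
    conclusion because the strictness argument on sections asks for it. *)
Lemma ae_eq_of_le_integral d (T : measurableType d) (nu : {measure set T -> \bar R})
    (A : set T) (g h : T -> \bar R) : measurable A ->
  measurable_fun A g -> measurable_fun A h ->
  (forall x, A x -> (0 <= g x)%E) -> (forall x, A x -> (g x <= h x)%E) ->
  (\int[nu]_(x in A) h x <= \int[nu]_(x in A) g x)%E ->
  (\int[nu]_(x in A) g x < +oo)%E ->
  {ae nu, forall x, A x -> h x = g x /\ (g x < +oo)%E}.
Proof.
move=> mA mg mh g0 gh le_int gfin.
have h0 x : A x -> (0 <= h x)%E by move=> Ax; rewrite (le_trans (g0 x Ax)) ?gh.
have eq_int : (\int[nu]_(x in A) h x = \int[nu]_(x in A) g x)%E.
  by apply/eqP; rewrite eq_le le_int ge0_le_integral.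
have Ig : nu.-integrable A g.
  apply/integrableP; split => //.
  rewrite (_ : (\int[nu]_(x in A) `|g x|)%E = (\int[nu]_(x in A) g x)%E)//.
  by apply: eq_integral => x /set_mem Ax; rewrite gee0_abs ?g0.
have Ih : nu.-integrable A h.
  apply/integrableP; split => //.
  rewrite (_ : (\int[nu]_(x in A) `|h x|)%E = (\int[nu]_(x in A) h x)%E).
    by rewrite eq_int.
  by apply: eq_integral => x /set_mem Ax; rewrite gee0_abs ?h0.
have FF := ae_filter_ringOfSetsType nu.
have agfin := integrable_ae mA Ig.
have ahfin := integrable_ae mA Ih.
have mD : measurable_fun A (h \- g)%E by exact: emeasurable_funB.
have /(ae_eq_integral_abs nu mA mD).1 adiff : (\int[nu]_(x in A) `|(h \- g) x| = 0)%E.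
  transitivity (\int[nu]_(x in A) (h \- g) x)%E.
    apply: ae_eq_integral => //; first exact: measurableT_comp.
    apply: (filterS2 _ _ agfin ahfin) => x gf hf Ax.
    move: (gh x Ax) (gf Ax) (hf Ax) => /=; case: (g x) (h x) => [a| |] [b| |]// ab _ _.
    by rewrite gee0_abs// -EFinB lee_fin subr_ge0 -lee_fin.
  rewrite integralB// eq_int subee// ge0_fin_numE//.
  exact: integral_ge0.
apply: (filterS3 _ _ agfin ahfin adiff) => x gf hf hg Ax.
move: (gf Ax) (hf Ax) (hg Ax); rewrite /=.
case: (g x) (h x) => [a| |] [b| |]// _ _ [] /eqP; rewrite subr_eq0 => /eqP ->.
by rewrite ltry.
Qed.

End Measurability.

(** * Monotone ratio of the conditional weights *)

Section Weights.
Context {R : realType}.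
Variables (f : R -> R).
Hypotheses (f0 : forall x, 0 <= f x) (f_MLR : MLR f).

Lemma range_of_ge0 (x : R * R) : 0 <= range_of x.
Proof. by rewrite subr_ge0 ge_min le_max lexx. Qed.

Lemma cond_weight0 u z : cond_weight f (0, 0) u z = 2 * (f (z - u) * f z).
Proof.
by rewrite /cond_weight /range_of /upper /lower/= maxxx minxx subrr !addr0; ring.
Qed.

(* Both summands of cond_weight f theta, divided by cond_weight f (0, 0), are
   ratios of the form f (z + t) / f z, hence nonincreasing in z. *)
Lemma cond_weight_ratio theta u x y : x <= y ->
  cond_weight f theta u y * cond_weight f (0, 0) u x <=
  cond_weight f theta u x * cond_weight f (0, 0) u y.
Proof.
rewrite le_eqVlt => /predU1P[->//|xy]; rewrite !cond_weight0 /cond_weight.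
have := range_of_ge0 theta; rewrite le_eqVlt => /predU1P[<-|].
  by rewrite !addr0 le_eqVlt; apply/orP; left; apply/eqP; ring.
set t := range_of theta => t0.
have h1 : f (x - u) * f (y - u + t) <= f (x - u + t) * f (y - u).
  by apply: MLR_ratio => //; rewrite ltrD2r.
have h2 : f x * f (y + t) <= f (x + t) * f y by exact: MLR_ratio.
have p1 : 0 <= f x * f y by rewrite mulr_ge0.
have p2 : 0 <= f (x - u) * f (y - u) by rewrite mulr_ge0.
have := ler_wpM2r p1 h1; have := ler_wpM2r p2 h2; nra.
Qed.

End Weights.

(** * Comparison of the estimators *)

Section Dominance.
Context {R : realType}.
Variables (f phi m : R -> R) (d : measure_display) (T : measurableType d)
  (P : R * R -> probability T R) (X1 X2 : {mfun T >-> R}).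
Hypotheses (f_density : is_density f) (X_model : location_model f P X1 X2)
  (f_MLR : MLR f) (m_median : is_median_at_zero f m)
  (phi_meas : measurable_fun (`[0, +oo[%classic : set R) phi).
Local Notation mu := (@lebesgue_measure R).
Local Notation pos := (`]0%R, +oo[%classic : set R).
Local Notation nneg := (`[0%R, +oo[%classic : set R).
Local Open Scope ereal_scope.

Let mf : measurable_fun [set: R] f. Proof. by case: f_density. Qed.

Let f0 x : (0 <= f x)%R. Proof. by case: f_density. Qed.

Let mw theta : measurable_fun [set: R * R]
  (fun p : R * R => (cond_weight f theta p.1 p.2)%:E).
Proof. by apply/measurable_EFinP; exact: measurable_cond_weight. Qed.

Let mw_section theta u : measurable_fun [set: R] (cond_weight f theta u).
Proof.
exact: (measurable_fun_pair2 (f := fun p : R * R => cond_weight f theta p.1 p.2) u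
  (measurable_cond_weight theta mf)).
Qed.

Let w0 theta u z : (0 <= cond_weight f theta u z)%R.
Proof. exact: cond_weight_ge0. Qed.

Let wE0 theta (p : R * R) : 0 <= (cond_weight f theta p.1 p.2)%:E.
Proof. by rewrite lee_fin. Qed.

Let halves u : (0 < u)%R -> exists2 k : R, (0 < k)%R &
    [/\ \int[mu]_(z in `]-oo, m u]) (cond_weight f (0, 0) u z)%:E = k%:E,
        \int[mu]_(z in `]m u, +oo[) (cond_weight f (0, 0) u z)%:E = k%:E &
        forall c : R, (m u <= c)%R <->
          \int[mu]_(z in `]c, +oo[) (cond_weight f (0, 0) u z)%:E <=
          \int[mu]_(z in `]-oo, c]) (cond_weight f (0, 0) u z)%:E].
Proof. by move=> u0; apply: unique_median_halves => //; exact: m_median. Qed.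

(** By the last clause of [halves], [c < m u] is equivalent to [lo u < up u], an inequality between
    section integrals that are measurable in [u]. *)
Lemma measurable_median : measurable_fun pos m.
Proof.
move=> mD; apply: (measurability _ (RGenOInfty.measurableE R)) => //.
move=> _ [_ [c ->] <-].
pose lo u := \int[mu]_(z in [set z | (z <= c)%R]) (cond_weight f (0, 0) u z)%:E.
pose up u := \int[mu]_(z in [set z | (c < z)%R]) (cond_weight f (0, 0) u z)%:E.
rewrite (_ : _ `&` _ = pos `&` [set u | lo u < up u]).
  apply: emeasurable_fun_lt => //; apply: (measurable_funS measurableT) => //.
  - have mB : measurable [set p : R * R | (p.2 <= c)%R].
      rewrite (_ : [set _ | _] = ~` [set p : R * R | (c < p.2)%R]).
        by apply: measurableC; exact: measurable_lt_set.
      by apply/seteqP; split => p /=; rewrite leNgt => /negP.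
    exact: (measurable_section_integral mB (mw (0%R, 0%R)) (@wE0 _)).
  - have mB : measurable [set p : R * R | (c < p.2)%R] by exact: measurable_lt_set.
    exact: (measurable_section_integral mB (mw (0%R, 0%R)) (@wE0 _)).
apply/seteqP; split => u /=; rewrite !in_itv/= !andbT => -[u0].
  have [k _ [_ _ mc]] := halves u0.
  rewrite ltNge => cm; split => //; rewrite ltNge; apply: contra cm.
  by rewrite /lo /up -set_itvoy -set_itvNyc => /mc.
have [k _ [_ _ mc]] := halves u0.
rewrite ltNge => cm; split => //; rewrite ltNge; apply: contra cm.
by rewrite /lo /up -set_itvoy -set_itvNyc => /mc.
Qed.

Lemma measurable_median_ge0 : measurable_fun nneg m.
Proof.
rewrite (_ : nneg = [set 0%R] `|` pos).
  apply/measurable_funU => //; split; first exact: measurable_fun_set1.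
  exact: measurable_median.
by rewrite setU1itv.
Qed.

Let U w := range_of (X1 w, X2 w).
Let V w := upper (X1 w, X2 w).

Let U_ge0 w : (0 <= U w)%R. Proof. exact: range_of_ge0. Qed.

Let mV : measurable_fun setT V.
Proof. exact: measurable_maxr. Qed.

Let mU : measurable_fun setT U.
Proof. by apply: measurable_funB => //; exact: measurable_minr. Qed.

Let mcompU (g : R -> R) : measurable_fun nneg g ->
  measurable_fun setT (g \o U).
Proof.
move=> mg; apply: (@measurable_comp _ _ _ _ _ _ nneg g setT U _ _ mg mU) => //.
by move=> _ [w _ <-]; rewrite /= in_itv/= andbT.
Qed.

(** Ties [u = 0] are left out because [m] is characterized for positive [u] only. *)
Let above : set R := [set u | (0 < u)%R /\ (m u < phi u)%R].

Let m_above : measurable above.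
Proof.
rewrite (_ : above = pos `&` [set u | (m u < phi u)%R]).
  rewrite -[X in _ `&` X](_ : (fun u => m u < phi u)%R @^-1` [set true] = _)//.
  apply: measurable_fun_ltr => //; first exact: measurable_median.
  apply: measurable_funS phi_meas => //.
  by move=> u; rewrite /= !in_itv/= !andbT; exact: ltW.
by apply/seteqP; split => u /=; rewrite in_itv/= andbT.
Qed.

Let lo theta u := \int[mu]_(z in `]-oo, m u]) (cond_weight f theta u z)%:E.
Let up theta u := \int[mu]_(z in `]m u, +oo[) (cond_weight f theta u z)%:E.

Let below (theta : R * R) := [set w | above (U w) /\ (V w - upper theta <= m (U w))%R].
Let over (theta : R * R) := [set w | above (U w) /\ (m (U w) < V w - upper theta)%R].

(** Extending [m] by 0 gives a function measurable on the whole line, so that [Bup] and [Blo] are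
    measurable in the plane. *)
Let m_restr : measurable_fun [set: R] (m \_ pos).
Proof.
by apply/(measurable_restrictT _ _).1 => //; exact: measurable_median.
Qed.

Let m_restrE u : (0 < u)%R -> (m \_ pos) u = m u.
Proof. by move=> u0; rewrite patchE mem_set//= in_itv/= u0. Qed.

Let Bup : set (R * R) := [set p | above p.1 /\ ((m \_ pos) p.1 < p.2)%R].
Let Blo : set (R * R) := [set p | above p.1 /\ (p.2 <= (m \_ pos) p.1)%R].

Let mfst_above : measurable [set p : R * R | above p.1].
Proof.
rewrite -[X in measurable X]setTI.
have := @measurable_fst _ _ R R measurableT above m_above.
by [].
Qed.

Let mBup : measurable Bup.
Proof.
apply: measurableI => //; apply: measurable_lt_set => //.
exact: measurableT_comp.
Qed.

Let mBlo : measurable Blo.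
Proof.
rewrite (_ : Blo = [set p | above p.1] `\` Bup); first exact: measurableD.
apply/seteqP; split => p /= [ap].
  by rewrite leNgt => /negP h; split => // -[].
by move=> h; split => //; rewrite leNgt; apply/negP => ?; apply: h.
Qed.

Let integral_above (B : set (R * R)) theta (S : R -> set R) :
  (forall u z, B (u, z) <-> above u /\ S u z) ->
  \int[mu]_u \int[mu]_(z in [set z | B (u, z)]) (cond_weight f theta u z)%:E =
  \int[mu]_(u in above) \int[mu]_(z in S u) (cond_weight f theta u z)%:E.
Proof.
move=> BS; rewrite [RHS]integral_mkcond; apply: eq_integral => u _.
rewrite patchE; case: ifPn => [/set_mem au|/negP nu].
  by congr (integral _ _ _); apply/seteqP; split => z /=; rewrite BS => // -[].
rewrite (_ : [set z | _] = set0) ?integral_set0//.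
by apply/seteqP; split => z //= /BS[au _]; apply: nu; rewrite inE.
Qed.

Lemma law_below theta : P theta (below theta) = \int[mu]_(u in above) lo theta u.
Proof.
have [indep dX1 dX2] := X_model theta.
have := range_law mf f0 indep dX1 dX2 mBlo.
rewrite (_ : [set p | (0 < p.1)%R /\ Blo p] = Blo); last first.
  by apply/seteqP; split => [p []//|p /= h]; split => //; case: h => -[].
rewrite (integral_section mBlo (mw theta) (@wE0 theta))/=.
rewrite (@integral_above Blo theta (fun u => `]-oo, m u]%classic)); last first.
  by move=> u z; rewrite /Blo/= in_itv/=; split => -[au]; rewrite m_restrE//; case: au.
move=> <-; congr (P theta _); apply/seteqP; split => w /=.
  by move=> [au h]; split; [case: au|split => //=; rewrite m_restrE//; case: au].
by move=> [u0 [au]] /=; rewrite m_restrE.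
Qed.

Lemma law_over theta : P theta (over theta) = \int[mu]_(u in above) up theta u.
Proof.
have [indep dX1 dX2] := X_model theta.
have := range_law mf f0 indep dX1 dX2 mBup.
rewrite (_ : [set p | (0 < p.1)%R /\ Bup p] = Bup); last first.
  by apply/seteqP; split => [p []//|p /= h]; split => //; case: h => -[].
rewrite (integral_section mBup (mw theta) (@wE0 theta))/=.
rewrite (@integral_above Bup theta (fun u => `]m u, +oo[%classic)); last first.
  by move=> u z; rewrite /Bup/= in_itv/= andbT; split => -[au]; rewrite m_restrE//; case: au.
move=> <-; congr (P theta _); apply/seteqP; split => w /=.
  by move=> [au h]; split; [case: au|split => //=; rewrite m_restrE//; case: au].
by move=> [u0 [au]] /=; rewrite m_restrE.
Qed.


Lemma up_le_lo theta u : (0 < u)%R -> up theta u <= lo theta u.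
Proof.
move=> u0; have [k k0 [elo eup _]] := halves u0.
apply: (upper_le_lower (g := cond_weight f (0%R, 0%R) u) (k := k)) => //.
by move=> x y; exact: cond_weight_ratio.
Qed.

Let measurable_lo theta : measurable_fun above (lo theta).
Proof.
have := measurable_section_integral mBlo (mw theta) (@wE0 theta).
move=> /(measurable_funS measurableT (@subsetT _ above)).
apply: eq_measurable_fun => u /set_mem au.
congr (integral _ _ _); apply/seteqP; split => z /=; rewrite /Blo/= in_itv/=.
  by move=> [_]; rewrite m_restrE//; case: au.
by move=> zm; split => //; rewrite m_restrE//; case: au.
Qed.

Let measurable_up theta : measurable_fun above (up theta).
Proof.
have := measurable_section_integral mBup (mw theta) (@wE0 theta).
move=> /(measurable_funS measurableT (@subsetT _ above)).
apply: eq_measurable_fun => u /set_mem au.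
congr (integral _ _ _); apply/seteqP; split => z /=; rewrite /Bup/= in_itv/= andbT.
  by move=> [_]; rewrite m_restrE//; case: au.
by move=> zm; split => //; rewrite m_restrE//; case: au.
Qed.

Let up_ge0 theta u : 0 <= up theta u.
Proof. by apply: integral_ge0 => z _; rewrite lee_fin. Qed.

Let lo_ge0 theta u : 0 <= lo theta u.
Proof. by apply: integral_ge0 => z _; rewrite lee_fin. Qed.

Lemma law_over_le_below theta : P theta (over theta) <= P theta (below theta).
Proof.
rewrite law_below law_over; apply: ge0_le_integral => //.
- exact: measurable_up.
- exact: measurable_lo.
by move=> u [u0 _]; exact: up_le_lo.
Qed.

(** Ties are the event that the observations lie on the diagonal, whose sections are single
    points. *)
Lemma range_null theta : P theta [set w | U w = 0%R] = 0.
Proof.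
have [indep dX1 dX2] := X_model theta.
have mshift (r : R) : measurable_fun [set: R] (fun x => f (x - r)%R).
  by apply: measurableT_comp => //; exact: measurable_funB.
have mdiag : measurable [set x : R * R | x.1 = x.2] by exact: measurable_eq_set.
rewrite (_ : [set w | _] = (fun w => (X1 w, X2 w)) @^-1` [set x | x.1 = x.2]).
  rewrite (joint_density _ _ _ _ indep dX1 dX2)// integral_section//.
  - rewrite integral0_eq// => x _.
    rewrite (_ : [set z | _] = [set x]) ?integral_set1//.
    by apply/seteqP; split => z /= ->.
  - apply/measurable_EFinP/measurable_funM.
      exact: (measurableT_comp (mshift theta.1)).
    exact: (measurableT_comp (mshift theta.2)).
  - by move=> x; rewrite lee_fin mulr_ge0.
apply/seteqP; split => w /=; rewrite /U /range_of /upper /lower/=.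
  by case: (ltgtP (X1 w) (X2 w)) => // ? /eqP; rewrite subr_eq0 ?gt_eqF// => /eqP.
by move=> ->; rewrite maxxx minxx subrr.
Qed.

(** Otherwise the weight at the origin would vanish identically, against the positive mass [k] below
    the median. *)
Let wide v : (0 < v)%R -> exists2 z, (0 < f z)%R & (0 < f (z - v))%R.
Proof.
move=> v0; have [k k0 [elo _ _]] := halves v0.
apply: contrapT => nz; move: elo; rewrite integral0_eq.
  by move=> -[] kE; move: k0; rewrite -kE ltxx.
move=> z _; rewrite cond_weight0.
have [fz|fz] := ltP 0%R (f z); last first.
  by have -> : f z = 0%R by [apply/eqP; rewrite eq_le fz f0]; rewrite !mulr0.
have [fzv|fzv] := ltP 0%R (f (z - v)); first by exfalso; apply: nz; exists z.
have -> : f (z - v) = 0%R by apply/eqP; rewrite eq_le fzv f0.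
by rewrite mul0r mulr0.
Qed.

(* For u < t the two conditional laws cannot be proportional, so the
   inequality up <= lo is strict there. *)
Let strict_section t u : (0 < u)%R -> (u < t)%R ->
  up (0, t)%R u < +oo -> lo (0, t)%R u <> up (0, t)%R u.
Proof.
move=> u0 ut upfin lo_up; have [k k0 [elo eup _]] := halves u0.
have t0 : (0 < t)%R by exact: lt_trans ut.
have range_t : range_of (0, t)%R = t.
  by rewrite /range_of /upper /lower/= max_r ?min_l ?subr0 ?ltW.
have [c wc] : exists c : R, {ae mu, forall z,
    cond_weight f (0, t)%R u z = c * cond_weight f (0, 0)%R u z}%R.
  apply: (lower_eq_upper_ae (m := m u) (k := k)) => //.
  - by move=> x y; exact: cond_weight_ratio.
  - by rewrite -[leLHS]/(lo _ _) lo_up.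
apply: (@MLR_not_proportional _ f f0 f_MLR t u (c * 2)%R u0 ut _ mf _ wide).
  have FF := ae_filter_ringOfSetsType mu.
  apply: (filterS _ wc) => z; rewrite /= cond_weight0 /cond_weight range_t mulrA.
  exact.
by case: f_density.
Qed.

Let mUV theta : measurable_fun [set: T] (fun w => (U w, V w - upper theta)%R).
Proof. by apply: measurable_fun_pair => //; exact: measurable_funB. Qed.

Let measurable_below theta : measurable (below theta).
Proof.
rewrite (_ : below theta = setT `&` (fun w => (U w, V w - upper theta)%R) @^-1` Blo).
  exact: (mUV theta measurableT mBlo).
rewrite setTI; apply/seteqP; split => w /= [au h]; split => //; move: h => /=;
  by rewrite m_restrE//; case: au.
Qed.

Let measurable_over theta : measurable (over theta).
Proof.
rewrite (_ : over theta = setT `&` (fun w => (U w, V w - upper theta)%R) @^-1` Bup).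
  exact: (mUV theta measurableT mBup).
rewrite setTI; apply/seteqP; split => w /= [au h]; split => //; move: h => /=;
  by rewrite m_restrE//; case: au.
Qed.

(** This is the event of the hypothesis on [phi]. It may contain ties, which [gap_sub] separates as
    a null event. *)
Let gap := [set w | (m (U w) < phi (U w))%R].

Let measurable_gap : measurable gap.
Proof.
apply: measurable_lt_set; apply: mcompU => //; exact: measurable_median_ge0.
Qed.

Let gap_sub theta : gap `<=` (below theta `|` over theta) `|` [set w | U w = 0%R].
Proof.
move=> w gw; have := U_ge0 w; rewrite le_eqVlt => /predU1P[U0|U0]; first by right.
by left; case: (leP (V w - upper theta)%R (m (U w))) => h; [left|right].
Qed.

Let measurable_null : measurable [set w | U w = 0%R].
Proof. exact: measurable_eq_set. Qed.

(** If no parameter were strict, equality at each [(0, n.+1)] would make the part of [above] below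
    [n.+1] null by [strict_section]. Then [above] is null, and so is the gap event under
    [theta0]. *)
Lemma exists_over_lt_below theta0 : P theta0 [set w | (m (U w) < phi (U w))%R] <> 0 ->
  exists theta, P theta (over theta) < P theta (below theta).
Proof.
move=> Pabove; apply: contrapT => none; apply: Pabove.
have eq_laws n : {ae mu, forall u, ~ (above u /\ (u < n.+1%:R)%R)}.
  have le_laws : P (0, n.+1%:R)%R (below (0, n.+1%:R)%R) <=
      P (0, n.+1%:R)%R (over (0, n.+1%:R)%R).
    by rewrite leNgt; apply/negP => lt; apply: none; eexists; exact: lt.
  rewrite law_below law_over in le_laws.
  (* The integral is a probability, which gives the finiteness required for the almost everywhere
     comparison. *)
  have upfin : \int[mu]_(u in above) up (0, n.+1%:R)%R u < +oo.
    by rewrite -law_over (le_lt_trans (probability_le1 _ _)) ?ltry.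
  have := @ae_eq_of_le_integral R _ (measurableTypeR R) mu above _ _ m_above
    (measurable_up _) (measurable_lo _)
    (fun u _ => up_ge0 _ u) (fun u au => up_le_lo _ au.1) le_laws upfin.
  have FF := ae_filter_ringOfSetsType mu.
  apply: filterS => u H [au un]; have [lo_up upu] := H au.
  exact: strict_section au.1 un upu lo_up.
(* Each [u] in [above] lies below some [n.+1], so countably many null sets cover [above]. *)
have mu0 : mu above = 0.
  apply/negligibleP => //; have [N [mN N0 sub]] := ae_foralln eq_laws.
  exists N; split => // u au; apply: sub => /= H.
  apply: (H (Num.bound u)); split => //.
  by rewrite (lt_trans (archi_boundP _))// ?ltr_nat//; case: au => /ltW.
have below0 : P theta0 (below theta0) = 0.
  by rewrite law_below; apply: null_set_integral => //; exact: measurable_lo.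
have over0 : P theta0 (over theta0) = 0.
  by rewrite law_over; apply: null_set_integral => //; exact: measurable_up.
apply: (subset_measure0 measurable_gap _ (gap_sub theta0)).
  by do 2 apply: measurableU => //.
apply: etrans (measureU0 (measurableU _ _ (measurable_below _) (measurable_over _))
  measurable_null (range_null _)) _.
exact: etrans (measureU0 (measurable_below _) (measurable_over _) over0) below0.
Qed.

Variable W : R -> R.
Hypotheses (W_ge0 : forall x, (0 <= W x)%R) (W_C1 : C1 W).

Let phi0 u := Num.min (phi u) (m u).

Let L1 theta w := loss W theta (delta phi0 (X1 w, X2 w)).
Let L2 theta w := loss W theta (delta phi (X1 w, X2 w)).

Let measurable_loss theta (g : R -> R) : measurable_fun nneg g ->
  measurable_fun [set: T] (fun w => loss W theta (delta g (X1 w, X2 w))).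
Proof.
move=> mg; apply: (measurableT_comp (C1_measurable W_ge0 W_C1)).
apply: measurable_funB => //; apply: measurable_funB => //; exact: mcompU mg.
Qed.

Let mL1 theta : measurable_fun [set: T] (L1 theta).
Proof.
by apply: measurable_loss; apply: measurable_minr => //; exact: measurable_median_ge0.
Qed.

Let mL2 theta : measurable_fun [set: T] (L2 theta).
Proof. exact: measurable_loss. Qed.

(** Here both errors are at most 0 and that of [phi] is the smaller one. If the error of [phi0] is
    exactly 0, its loss is 0 and [C1_pos] gives strictness. *)
Let below_sub theta : below theta `<=` [set w | (L1 theta w < L2 theta w)%R].
Proof.
move=> w [[_ m_phi] Vm]; rewrite /= /L1 /L2 /loss /delta -/(U w) -/(V w) /phi0.
rewrite min_r ?ltW//; have [W0 Wn _] := W_C1.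
have : (V w - m (U w) - upper theta <= 0)%R by lra.
rewrite le_eqVlt => /predU1P[h|h]; last by apply: Wn => //; lra.
by rewrite h W0; apply: (C1_pos W_ge0 W_C1); lra.
Qed.

Let gapC_sub theta : ~` gap `<=` [set w | L1 theta w = L2 theta w].
Proof.
move=> w /negP; rewrite -leNgt => phi_m.
by rewrite /= /L1 /L2 /loss /delta -/(U w) -/(V w) /phi0 min_l.
Qed.

(** The event [below] counts fully, and the complement of the gap, of probability at least
    [1 - (a + b)], counts half. The bound equals [1/2 + (a - b) / 2], so only the order of [a] and
    [b] matters. *)
Lemma GPN_ge theta : exists a b : R,
  [/\ P theta (below theta) = a%:E, P theta (over theta) = b%:E &
      (a + 2^-1 * (1 - (a + b)))%:E <=
      GPN (P theta) X1 X2 W (delta phi0) (delta phi) theta].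
Proof.
pose Q := P theta; pose lt_set := [set w | (L1 theta w < L2 theta w)%R].
pose eq_set := [set w | L1 theta w = L2 theta w].
have mlt : measurable lt_set by exact: measurable_lt_set.
have meq : measurable eq_set by exact: measurable_eq_set.
have real_prob A : measurable A -> exists r, Q A = r%:E.
  by move=> mA; exists (fine (Q A)); rewrite fineK// fin_num_measure.
have [a Qa] := real_prob _ (measurable_below theta).
have [b Qb] := real_prob _ (measurable_over theta).
have [l Ql] := real_prob _ mlt.
have [q Qq] := real_prob _ meq.
have [g Qg] := real_prob _ measurable_gap.
exists a, b; split => //.
rewrite /GPN -/(L1 theta) -/(L2 theta) -[X in X + _]/(Q lt_set).
rewrite -[X in _ * X]/(Q eq_set) Ql Qq -EFinM -EFinD lee_fin.
have al : (a <= l)%R by rewrite -lee_fin -Qa -Ql le_measure ?inE.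
have gq : (1 - g <= q)%R.
  rewrite -lee_fin EFinB -Qg -Qq -probability_setC//.
  by apply: le_measure; rewrite ?inE//; [exact: measurableC|exact: gapC_sub].
have gab : (g <= a + b)%R.
  rewrite -lee_fin EFinD -Qa -Qb -Qg.
  have mbo := measurableU _ _ (measurable_below theta) (measurable_over theta).
  apply: (@le_trans _ _ (Q (below theta `|` over theta))).
    rewrite -(measureU0 mbo measurable_null (range_null theta)).
    by apply: le_measure; rewrite ?inE//; exact: measurableU.
  exact: measureU2.
lra.
Qed.

Lemma GPN_dominance : (exists theta, P theta gap <> 0) ->
  (forall theta, (2^-1)%:E <= GPN (P theta) X1 X2 W (delta phi0) (delta phi) theta) /\
  (exists theta, (2^-1)%:E < GPN (P theta) X1 X2 W (delta phi0) (delta phi) theta).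
Proof.
move=> [theta0 Pgap]; split => [theta|].
  have [a [b [Pa Pb]]] := GPN_ge theta; apply: le_trans.
  by have := law_over_le_below theta; rewrite Pa Pb !lee_fin; lra.
have [theta ba] := exists_over_lt_below Pgap; exists theta.
have [a [b [Pa Pb]]] := GPN_ge theta; apply: lt_le_trans.
by move: ba; rewrite Pa Pb !lte_fin; lra.
Qed.

End Dominance.

Theorem theorem4p4 (R : realType) (f W phi m : R -> R)
    (d : measure_display) (T : measurableType d)
    (P : R * R -> probability T R) (X1 X2 : {mfun T >-> R})
    (f_density : is_density f)
    (X_model : location_model f P X1 X2)
    (f_MLR : MLR f)
    (W_ge0 : forall x, 0 <= W x)
    (W_C1 : C1 W) (W_C2 : C2 W) (W_C3 : C3 f W)
    (m_median : is_median_at_zero f m)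
    (phi_meas : measurable_fun (`[0, +oo[%classic : set R) phi)
    (phi_above : exists theta : R * R,
       P theta [set w | m (range_of (X1 w, X2 w)) < phi (range_of (X1 w, X2 w))]
         <> 0%E) :
  let phi0 := fun u : R => Num.min (phi u) (m u) in
  (forall theta : R * R,
     ((2^-1)%:E <= GPN (P theta) X1 X2 W (delta phi0) (delta phi) theta)%E) /\
  (exists theta : R * R,
     ((2^-1)%:E < GPN (P theta) X1 X2 W (delta phi0) (delta phi) theta)%E).
Proof.
exact: (GPN_dominance f_density X_model f_MLR m_median phi_meas W_ge0 W_C1 phi_above).
Qed.
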